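(* Let $M$ be a $3\times3$ semi-magic square with upshifted representative $\mathbf a=(a_1,\dots,a_6)$, and let $m_0=\min(M)$. Then the number of lattice paths in $M(3)$ from the zero matrix to $M$ is $$v(M)=\sum_{t=0}^{m_0}\binom{\rho(M)}{a_1-t,\ a_2-t,\ a_3-t,\ a_4+t,\ a_5+t,\ a_6+t}.$$ Moreover, $v$ is constant on each orbit of the group $G$, i.e. $v(g\cdot M)=v(M)$ for all $g\in G$.
   Context: A semi-magic square of size 3 is a $3\times 3$ matrix with non-negative integer entries whose row sums and column sums all equal a common value $\rho(M)$ (the line sum); $M(3)$ is the set of all of them, and $\min(M)$ denotes the minimal entry of $M$. Fix the permutation matrices $P_1=I$, $P_2=\begin{bmatrix}0&0&1\\1&0&0\\0&1&0\end{bmatrix}$, $P_3=\begin{bmatrix}0&1&0\\0&0&1\\1&0&0\end{bmatrix}$, $P_4=\begin{bmatrix}0&0&1\\0&1&0\\1&0&0\end{bmatrix}$, $P_5=\begin{bmatrix}0&1&0\\1&0&0\\0&0&1\end{bmatrix}$, $P_6=\begin{bmatrix}1&0&0\\0&0&1\\0&1&0\end{bmatrix}$ (note $P_1+P_2+P_3=P_4+P_5+P_6$ is the all-ones matrix). A sextuple $\mathbf a$ of non-negative integers represents $M$ if $M=\sum_t a_tP_t$; every $M\in M(3)$ has such representatives, any two differing by an integer multiple of $(1,1,1,-1,-1,-1)$, and the upshifted representative is the unique one with $a_t=0$ for some $t\in\{4,5,6\}$. A lattice path in $M(3)$ from $0$ to $M$ is a sequence $0=M_0,M_1,\dots,M_{\rho(M)}=M$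 of matrices with each $M_i-M_{i-1}$ a $3\times3$ permutation matrix; $v(M)$ denotes the number of such paths. Multinomial coefficients are taken to be $0$ when some lower index is negative. $G$ is the group of transformations of $3\times 3$ matrices generated by row permutations, column permutations and transposition. *)

(* Defs.v *)
From HB Require Import structures.
From mathcomp Require Import all_boot all_order all_algebra all_fingroup.
From mathcomp Require Import finmap boolp classical_sets functions cardinality.

Set Implicit Arguments.
Unset Strict Implicit.
Unset Printing Implicit Defensive.

Import GRing.Theory.
Local Open Scope ring_scope.

Notation mat := 'M[nat]_3.

(* The common line sum, read off the first row; only meaningful on [semimagic]
   matrices. *)
Definition line_sum (M : mat) : nat := (\sum_(j < 3) M ord0 j)%N.

Definition semimagic (M : mat) : bool :=
  [forall i : 'I_3, (\sum_(j < 3) M i j)%N == line_sum M] &&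
  [forall j : 'I_3, (\sum_(i < 3) M i j)%N == line_sum M].

Definition min_entry (M : mat) : nat :=
  \big[minn/M ord0 ord0]_(i < 3) \big[minn/M ord0 ord0]_(j < 3) M i j.

Definition mat_of_rows (rows : seq (seq nat)) : mat :=
  \matrix_(i < 3, j < 3) nth 0%N (nth [::] rows i) j.

Definition P1 : mat := mat_of_rows [:: [:: 1; 0; 0]; [:: 0; 1; 0]; [:: 0; 0; 1]]%N.
Definition P2 : mat := mat_of_rows [:: [:: 0; 0; 1]; [:: 1; 0; 0]; [:: 0; 1; 0]]%N.
Definition P3 : mat := mat_of_rows [:: [:: 0; 1; 0]; [:: 0; 0; 1]; [:: 1; 0; 0]]%N.
Definition P4 : mat := mat_of_rows [:: [:: 0; 0; 1]; [:: 0; 1; 0]; [:: 1; 0; 0]]%N.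
Definition P5 : mat := mat_of_rows [:: [:: 0; 1; 0]; [:: 1; 0; 0]; [:: 0; 0; 1]]%N.
Definition P6 : mat := mat_of_rows [:: [:: 1; 0; 0]; [:: 0; 0; 1]; [:: 0; 1; 0]]%N.

Definition represents (a1 a2 a3 a4 a5 a6 : nat) (M : mat) : Prop :=
  M = P1 *+ a1 + P2 *+ a2 + P3 *+ a3 + P4 *+ a4 + P5 *+ a5 + P6 *+ a6.

Definition upshifted_representative (a1 a2 a3 a4 a5 a6 : nat) (M : mat) : Prop :=
  represents a1 a2 a3 a4 a5 a6 M /\ [\/ a4 = 0%N, a5 = 0%N | a6 = 0%N].

(* [B - A] is a permutation matrix, without subtraction on [nat]. *)
Definition perm_step (A B : mat) : bool :=
  [exists s : 'S_3, B == A + perm_mx s].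

(* The list [p] is [M_1; ...; M_rho]; the initial matrix [M_0 = 0] is left
   implicit, as is usual with [path]. *)
Definition lattice_path (M : mat) (p : seq mat) : bool :=
  [&& size p == line_sum M, all semimagic (0 :: p),
      path perm_step 0 p & last 0 p == M].

Definition lattice_paths (M : mat) : set (seq mat) :=
  [set p | lattice_path M p]%classic.

Lemma finite_perm_paths (n : nat) (A : mat) :
  finite_set [set p : seq mat | (size p == n) && path perm_step A p]%classic.
Proof.
elim: n A => [|n IHn] A.
  apply: (@sub_finite_set _ _ [set [::]]%classic); last exact: finite_set1.
  by move=> p /= /andP[/nilP ->].
apply: (@sub_finite_set _ _
  (\bigcup_(s in [set: 'S_3]) (cons (A + perm_mx s) @`
     [set p : seq mat | (size p == n) && path perm_step (A + perm_mx s) p]))%classic).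
  case=> [|B p] //= /andP[sz_p /andP[/existsP[s /eqP ->] pp]].
  by exists s => //; exists p => //=; rewrite pp andbT.
apply: bigcup_finite; first exact: finite_finset.
by move=> s _; apply: finite_image; apply: IHn.
Qed.

(* [fset_set] is the empty set on infinite sets, so finiteness is what makes
   [num_paths] an actual count. *)
Lemma finite_lattice_paths (M : mat) : finite_set (lattice_paths M).
Proof.
apply: sub_finite_set (finite_perm_paths (line_sum M) 0).
by move=> p /and4P[/= -> _ -> _].
Qed.

Definition num_paths (M : mat) : nat := #|` fset_set (lattice_paths M)|%fset.

(* The division is exact when the lower indices are nonnegative and sum to [n]. *)
Definition multinomial (n : nat) (ks : seq int) : nat :=
  if all (fun k : int => 0 <= k) ks
  then (n`! %/ \prod_(k <- ks) (absz k)`!)%N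
  else 0%N.

(* The group of transformations generated by row permutations, column
   permutations and transposition. *)
Inductive in_G : (mat -> mat) -> Prop :=
| in_G_row (s : 'S_3) : in_G (row_perm s)
| in_G_col (s : 'S_3) : in_G (col_perm s)
| in_G_tr : in_G trmx
| in_G_id : in_G id
| in_G_comp (g h : mat -> mat) : in_G g -> in_G h -> in_G (g \o h)
| in_G_inv (g h : mat -> mat) : in_G g -> cancel g h -> cancel h g -> in_G h.

(* Main.v *)
Require Import Defs.
From mathcomp Require Import all_boot all_order all_algebra.
From mathcomp Require Import all_fingroup finmap classical_sets cardinality zify.
Local Open Scope ring_scope.

(* A lattice path to M is a word in the letters P_1, ..., P_6 with sum M (its
   successive steps); the semi-magic and length conditions are then automatic.
   Such a word has letter multiplicities b with sum_k b_k P_k = M, and comparing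
   b with the upshifted representative a entry by entry forces
   b = a + t (-1,-1,-1,1,1,1) with 0 <= t <= min(a_1,a_2,a_3) = min(M).  So the
   words split into classes indexed by t, each consisting of the permutations of
   one multiset.  Invariance holds because every g in G is a bijection fixing 0
   and preserving the step relation, so it acts on paths termwise. *)

Import GRing.Theory.

Set Implicit Arguments.
Unset Strict Implicit.
Unset Printing Implicit Defensive.

(** * Counting the arrangements of a multiset *)

(** Used twice: in [nat] to split a length by letters, and on matrices to collect equal steps of a
    word. *)
Lemma big_count_mem (T : eqType) (V : nmodType) (F : T -> V) (s u : seq T) :
  uniq u -> {subset s <= u} ->
  \sum_(x <- s) F x = \sum_(x <- u) F x *+ count_mem x s.
Proof.
move=> uniq_u; elim: s => [|y s IHs] sub_su.
  by rewrite big_nil big1.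
rewrite big_cons IHs; last by move=> x s_x; rewrite sub_su // inE s_x orbT.
under [RHS]eq_bigr => x _ do rewrite /= mulrnDr.
rewrite big_split; congr +%R.
rewrite (bigD1_seq y) ?sub_su ?mem_head //= eqxx big1 ?addr0 // => x.
by rewrite eq_sym => /negPf ->.
Qed.

(** Induction on the length, sorting arrangements by first letter [x]; the rest arranges [rem x s].
    Restoring [x] multiplies the factorial product by its multiplicity, and the multiplicities add
    up to [size s]. *)
Lemma size_multiset_permutations (T : eqType) (s u : seq T) :
  uniq u -> {subset s <= u} ->
  (size (permutations s) * \prod_(x <- u) (count_mem x s)`!)%N = (size s)`!.
Proof.
move=> uniq_u; move: {2}(size s) (erefl (size s)) => n; elim: n s => [|n IHn] s.
  by move/size0nil-> => _; rewrite big1_seq.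
move=> sz_s sub_su.
have s_gt0 : (0 < size s)%N by rewrite sz_s.
rewrite (perm_size (permutationsE s_gt0)) size_allpairs_dep sumnE big_map.
rewrite big_distrl sz_s /= factS -{1}sz_s.
have -> : size s = (\sum_(x <- undup s) count_mem x s)%N.
  rewrite -sum1_size [LHS](@big_count_mem _ _ _ s (undup s)) ?undup_uniq //.
    by apply: eq_bigr => x _; rewrite natn.
  by move=> x; rewrite mem_undup.
rewrite big_distrl; apply: eq_big_seq => x; rewrite mem_undup => s_x.
have sz_rem : size (rem x s) = n by rewrite size_rem // sz_s.
rewrite -[in RHS](sz_rem) -[in RHS](IHn (rem x s) sz_rem); last first.
  by move=> y /mem_rem /sub_su.
rewrite !(bigD1_seq x (sub_su _ s_x) uniq_u) /=.
have cnt_x : count_mem x s = (count_mem x (rem x s)).+1.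
  by rewrite (seq.permP (perm_to_rem s_x)) /= eqxx.
rewrite [in LHS]cnt_x factS -cnt_x.
rewrite (eq_bigr (fun y => (count_mem y (rem x s))`!)).
  lia.
by move=> y /negPf x'y; rewrite (seq.permP (perm_to_rem s_x)) /= eq_sym x'y.
Qed.

(** * The six permutation matrices as an alphabet *)

Definition steps : seq 'M[nat]_3 := [:: P1; P2; P3; P4; P5; P6].

Lemma uniq_steps : uniq steps.
Proof.
(* Flattening to the list of nine entries makes distinctness a computation. *)
pose entries (A : 'M[nat]_3) :=
  [seq A (inord i) (inord j) | i <- iota 0 3, j <- iota 0 3].
apply: (@map_uniq _ _ entries).
by rewrite /entries /= !mxE !inordK.
Qed.

(** The matrix is rebuilt from the three values of [s]; of the 27 triples below 3, only the six with
    distinct values survive. *)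
Lemma perm_mx_steps (s : 'S_3) : perm_mx s \in steps.
Proof.
have neq i j : (i < 3)%N -> (j < 3)%N -> i != j -> s (inord i) != s (inord j) :> nat.
  by move=> lti ltj neij; rewrite val_eqE (inj_eq perm_inj) -val_eqE /= !inordK.
have -> : perm_mx s = mat_of_rows
    [seq [seq (x == y : nat) | y <- iota 0 3] |
      x <- [seq val (s (inord i)) | i <- iota 0 3]].
  apply/matrixP => i j; rewrite !mxE (nth_map 0%N) ?size_map //.
  rewrite (nth_map 0%N) ?size_iota // (nth_map 0%N) ?size_iota // !nth_iota // !add0n.
  by rewrite inord_val val_eqE; case: eqP.
rewrite /= !inE.
move: (neq 0 1 isT isT isT) (neq 0 2 isT isT isT) (neq 1 2 isT isT isT)%N.
move: (ltn_ord (s (inord 0))) (ltn_ord (s (inord 1))) (ltn_ord (s (inord 2))).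
move: (nat_of_ord _) (nat_of_ord _) (nat_of_ord _).
by case=> [|[|[|?]]] [|[|[|?]]] [|[|[|?]]] //= *; rewrite eqxx ?orbT.
Qed.

(** The converse inclusion is by cardinality: 3! distinct permutation matrices lie in a list of
    length 6. *)
Lemma mem_steps (A : 'M[nat]_3) : reflect (exists s : 'S_3, A = perm_mx s) (A \in steps).
Proof.
have sub : {subset [seq perm_mx s | s : 'S_3] <= steps}.
  by move=> _ /mapP[s _ ->]; apply: perm_mx_steps.
have uniq_perm_mx : uniq [seq (perm_mx s : 'M[nat]_3) | s : 'S_3].
  rewrite map_inj_uniq ?enum_uniq // => s t /matrixP st.
  apply/permP => i; have /eqP := st i (s i).
  by rewrite !mxE eqxx; case: (t i =P s i) => // ->.
have [|_ <-] := uniq_min_size uniq_perm_mx sub.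
  by rewrite size_map -cardE card_Sn.
by apply: (iffP mapP) => [[s _ ->]|[s ->]]; exists s; rewrite ?mem_enum.
Qed.

(** * Representatives and their shifts *)

(** Each of [P1], [P2], [P3] shares exactly one cell with each of [P4], [P5], [P6], so the entries
    are the nine sums of a coefficient of the first triple and one of the second. *)
Lemma representsE (a1 a2 a3 a4 a5 a6 : nat) :
  P1 *+ a1 + P2 *+ a2 + P3 *+ a3 + P4 *+ a4 + P5 *+ a5 + P6 *+ a6 =
  mat_of_rows [:: [:: a1 + a6; a3 + a5; a2 + a4];
                  [:: a2 + a5; a1 + a4; a3 + a6];
                  [:: a3 + a4; a2 + a6; a1 + a5]]%N.
Proof.
apply/matrixP => i j; rewrite !mxE !mulmxnE !mxE.
case: i => [[|[|[|i]]] Hi] //; case: j => [[|[|[|j]]] Hj] //=; lia.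
Qed.

(** A vanishing coefficient among the last three makes [a1], [a2], [a3] themselves entries, and
    every entry is at least one of them. *)
Lemma leq_min_entry (a1 a2 a3 a4 a5 a6 : nat) (M : 'M[nat]_3) (t : nat) :
  upshifted_representative a1 a2 a3 a4 a5 a6 M ->
  (t <= min_entry M)%N = [&& t <= a1, t <= a2 & t <= a3]%N.
Proof.
case=> -> ups; rewrite representsE /min_entry !big_ord_recl !big_ord0 !mxE /=.
(* Thirteen inequalities arise: nine entries and four copies of the default [M ord0 ord0]. *)
rewrite !leq_min -!andbA; apply/idP/and3P => [|[le1 le2 le3]]; last first.
  by repeat (apply/andP; split); lia.
by do 15?[case/andP => ?]; case: ups => ?; split; lia.
Qed.

Lemma line_sum_represents (a1 a2 a3 a4 a5 a6 : nat) (M : 'M[nat]_3) :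
  represents a1 a2 a3 a4 a5 a6 M ->
  line_sum M = (a1 + a2 + a3 + a4 + a5 + a6)%N.
Proof.
by move=> ->; rewrite representsE /line_sum !big_ord_recl !big_ord0 !mxE /=; lia.
Qed.

(** Equality of all nine sums forces the first three coefficients to drop, and the last three to
    rise, by one common amount. *)
Lemma represents_shift (a1 a2 a3 a4 a5 a6 b1 b2 b3 b4 b5 b6 : nat) (M : 'M[nat]_3) :
  upshifted_representative a1 a2 a3 a4 a5 a6 M ->
  represents b1 b2 b3 b4 b5 b6 M <->
  exists2 t, (t <= min_entry M)%N &
    [:: b1; b2; b3; b4; b5; b6] = [:: a1 - t; a2 - t; a3 - t; a4 + t; a5 + t; a6 + t]%N.
Proof.
move=> up; have := leq_min_entry _ up; move: (min_entry M) => m le_m.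
case: up => ->; rewrite /represents !representsE => ups; split; last first.
  case=> t; rewrite le_m => /and3P[le1 le2 le3] [-> -> -> -> -> ->].
  by congr mat_of_rows; do ?congr cons; lia.
move/matrixP=> eqM.
have e (i j : nat) := eqM (inord i) (inord j).
move: (e 0 0) (e 0 1) (e 0 2) (e 1 0) (e 1 1) (e 1 2) (e 2 0) (e 2 1) (e 2 2)%N.
rewrite !mxE !inordK //= {e eqM} => *.
(* Since a4, a5 or a6 vanishes, [b4 - a4 = b5 - a5 = b6 - a6] is not truncated. *)
exists (b4 - a4)%N.
  by rewrite le_m; apply/and3P; case: ups => ?; split; lia.
by congr [:: _; _; _; _; _; _]; case: ups => ?; lia.
Qed.

(** * Line sums along a path *)

Lemma perm_stepP (A B : 'M[nat]_3) :
  reflect (exists2 P, P \in steps & B = A + P) (perm_step A B).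
Proof.
apply: (iffP existsP) => [[s /eqP ->]|[P /mem_steps[s ->] ->]]; last by exists s.
by exists (perm_mx s); rewrite ?perm_mx_steps.
Qed.

Lemma row_sumD_perm (A : 'M[nat]_3) (s : 'S_3) (i : 'I_3) :
  (\sum_(j < 3) (A + perm_mx s)%R i j = (\sum_(j < 3) A i j).+1)%N.
Proof.
under eq_bigr => j _ do rewrite !mxE.
rewrite big_split -[RHS]addn1; congr addn.
rewrite (bigD1 (s i)) //= eqxx big1 // => j.
by rewrite eq_sym => /negPf ->.
Qed.

Lemma col_sumD_perm (A : 'M[nat]_3) (s : 'S_3) (j : 'I_3) :
  (\sum_(i < 3) (A + perm_mx s)%R i j = (\sum_(i < 3) A i j).+1)%N.
Proof.
under eq_bigr => i _ do rewrite !mxE.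
rewrite big_split -[RHS]addn1; congr addn.
rewrite (bigD1 (s^-1%g j)) //= permKV eqxx big1 // => i.
by rewrite -(inj_eq (@perm_inj _ s)) permKV => /negPf ->.
Qed.

Lemma semimagic_perm_step (A B : 'M[nat]_3) :
  semimagic A -> perm_step A B -> semimagic B /\ line_sum B = (line_sum A).+1.
Proof.
move=> /andP[/forallP rowA /forallP colA] /existsP[s /eqP ->].
have lineB : line_sum (A + perm_mx s) = (line_sum A).+1 by exact: row_sumD_perm.
split=> //; rewrite /semimagic lineB.
by apply/andP; split; apply/forallP => i; rewrite ?row_sumD_perm ?col_sumD_perm eqSS.
Qed.

Lemma semimagic_path (A : 'M[nat]_3) (p : seq 'M[nat]_3) :
  semimagic A -> path perm_step A p ->
  all semimagic p /\ line_sum (last A p) = (line_sum A + size p)%N.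
Proof.
elim: p A => [|B p IHp] A magA /=; first by rewrite addn0.
case/andP => /(semimagic_perm_step magA)[magB lineB] /(IHp _ magB)[-> ->].
by rewrite magB lineB addnS.
Qed.

Lemma line_sum0 : line_sum 0 = 0%N.
Proof. by rewrite /line_sum big1 // => j _; rewrite mxE. Qed.

Lemma semimagic0 : semimagic 0.
Proof.
by apply/andP; split; apply/forallP => i; rewrite line_sum0 big1 // => j _; rewrite mxE.
Qed.

(** Line sums start at 0 and all grow by one per step, which yields the semi-magic and length
    conditions. *)
Lemma lattice_pathE (M : 'M[nat]_3) (p : seq 'M[nat]_3) :
  lattice_path M p = path perm_step 0 p && (last 0 p == M).
Proof.
apply/and4P/andP => [[_ _ -> ->] //|[path_p /eqP last_p]].
have [magp] := semimagic_path semimagic0 path_p.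
by rewrite line_sum0 last_p => ->; rewrite /= semimagic0 magp eqxx.
Qed.

(** * Paths as words in the steps *)

(** [scanl] omits its starting value, matching the implicit initial matrix of [lattice_path]. *)
Definition path_of (w : seq 'M[nat]_3) : seq 'M[nat]_3 := scanl +%R 0 w.

Lemma path_of_inj : injective path_of.
Proof.
(* Steps are recovered as differences of consecutive partial sums, where [subn] is exact. *)
apply: can_inj (scanlK (f := fun A B : 'M[nat]_3 => map2_mx subn B A) _ _).
by move=> A B; apply/matrixP => i j; rewrite !mxE addKn.
Qed.

Lemma last_scanl_add (A : 'M[nat]_3) (w : seq 'M[nat]_3) :
  last A (scanl +%R A w) = A + \sum_(P <- w) P.
Proof.
elim: w A => [|P w IHw] A /=; first by rewrite big_nil addr0.
by rewrite IHw big_cons addrA.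
Qed.

Lemma path_scanlP (A : 'M[nat]_3) (p : seq 'M[nat]_3) :
  reflect (exists2 w, {subset w <= steps} & p = scanl +%R A w) (path perm_step A p).
Proof.
apply: (iffP idP) => [|[w sub_w ->]]; last first.
  elim: w A sub_w => //= P w IHw A sub_w; rewrite IHw.
    by rewrite andbT; apply/perm_stepP; exists P; rewrite // sub_w ?mem_head.
  by move=> x w_x; rewrite sub_w // inE w_x orbT.
elim: p A => [|B p IHp] A /=; first by exists [::].
case/andP => /perm_stepP[P st_P ->] /IHp[w sub_w ->]; exists (P :: w) => // x.
by rewrite inE => /predU1P[->|/sub_w].
Qed.

Lemma lattice_pathP (M : 'M[nat]_3) (p : seq 'M[nat]_3) :
  reflect (exists2 w, {subset w <= steps} /\ \sum_(P <- w) P = M & p = path_of w)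
          (lattice_path M p).
Proof.
rewrite lattice_pathE; apply: (iffP andP) => [[/path_scanlP[w sub_w ->] /eqP]|].
  by rewrite last_scanl_add add0r => ?; exists w.
case=> w [sub_w sum_w] ->; rewrite last_scanl_add add0r sum_w; split=> //.
by apply/path_scanlP; exists w.
Qed.

Lemma num_pathsE (M : 'M[nat]_3) (L : seq (seq 'M[nat]_3)) :
  uniq L ->
  (forall w, w \in L <-> {subset w <= steps} /\ \sum_(P <- w) P = M) ->
  num_paths M = size L.
Proof.
move=> uniq_L memL; rewrite /num_paths -(size_map path_of).
have uniq_pL : uniq (map path_of L) by rewrite (map_inj_uniq path_of_inj).
have -> : fset_set (lattice_paths M) = [fset p in map path_of L]%fset.
  apply/fsetP => p; rewrite in_fset_set; last exact: finite_lattice_paths.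
  rewrite in_fset /=; apply/idP/mapP; rewrite in_setE /lattice_paths /=.
    by case/lattice_pathP => w /memL; exists w.
  by case=> w /memL w_L ->; apply/lattice_pathP; exists w.
by rewrite card_fseq undup_id.
Qed.

(** * Words with prescribed letter multiplicities *)

(** A canonical word with multiplicities [c]; its permutations form one class of words. *)
Definition multiset_word (T : Type) (u : seq T) (c : seq nat) : seq T :=
  flatten [seq nseq x.1 x.2 | x <- zip c u].

Lemma multiset_word_sub (T : eqType) (u : seq T) (c : seq nat) :
  {subset multiset_word u c <= u}.
Proof.
elim: u c => [|x u IHu] [|k c] //= y; rewrite mem_cat mem_nseq inE.
by case/orP => [/andP[_ ->] //|/IHu ->]; rewrite orbT.
Qed.

Lemma count_multiset_word (T : eqType) (u : seq T) (c : seq nat) :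
  uniq u -> size c = size u ->
  [seq count_mem x (multiset_word u c) | x <- u] = c.
Proof.
elim: u c => [|x u IHu] [|k c] //= /andP[u'x uniq_u] [sz_c].
rewrite count_cat count_nseq /= eqxx mul1n; congr cons.
  rewrite (count_memPn _) ?addn0 //.
  by apply: contra u'x; apply: multiset_word_sub.
rewrite -[RHS](IHu _ uniq_u sz_c); apply/eq_in_map => y u_y.
rewrite count_cat count_nseq /=; case: eqP => // eq_xy.
by rewrite eq_xy u_y in u'x.
Qed.

Lemma perm_eq_count (T : eqType) (u s1 s2 : seq T) :
  {subset s1 <= u} -> {subset s2 <= u} ->
  [seq count_mem x s1 | x <- u] = [seq count_mem x s2 | x <- u] ->
  perm_eq s1 s2.
Proof.
move=> sub1 sub2 /eq_in_map eq_cnt; apply/allP => x.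
by rewrite mem_cat => /orP[/sub1|/sub2] /eq_cnt /= ->.
Qed.

Lemma multinomial_nat (n : nat) (ks : seq nat) :
  multinomial n (map Posz ks) = (n`! %/ \prod_(k <- ks) k`!)%N.
Proof.
rewrite /multinomial big_map; case: allP => // -[] _ /mapP[k _ ->] //.
Qed.

Lemma size_permutations_multinomial (T : eqType) (u : seq T) (c : seq nat) :
  uniq u -> size c = size u ->
  size (permutations (multiset_word u c)) = multinomial (sumn c) (map Posz c).
Proof.
move=> uniq_u sz_c; have sub_u := @multiset_word_sub _ u c.
have sz_word : size (multiset_word u c) = sumn c.
  rewrite size_flatten /shape -map_comp; congr sumn.
  under eq_map => x do rewrite /= size_nseq.
  by rewrite -/(unzip1 _) unzip1_zip ?sz_c.
have prod_word : (\prod_(x <- u) (count_mem x (multiset_word u c))`! =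
                  \prod_(k <- c) k`!)%N.
  by rewrite -[in RHS](count_multiset_word uniq_u sz_c) big_map.
rewrite multinomial_nat -sz_word -(size_multiset_permutations uniq_u sub_u) prod_word.
by rewrite mulnK // prodn_gt0 // => x; apply: fact_gt0.
Qed.

(** * The path count as a sum of multinomials *)

Lemma sum_stepsE (M : 'M[nat]_3) (w : seq 'M[nat]_3) :
  {subset w <= steps} ->
  \sum_(P <- w) P = M <->
  represents (count_mem P1 w) (count_mem P2 w) (count_mem P3 w)
             (count_mem P4 w) (count_mem P5 w) (count_mem P6 w) M.
Proof.
move=> sub_w; rewrite (big_count_mem id uniq_steps sub_w) /represents.
by rewrite !big_cons big_nil addr0 !addrA; split=> ->.
Qed.

Lemma num_paths_multinomial (M : 'M[nat]_3) (a1 a2 a3 a4 a5 a6 : nat) :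
  upshifted_representative a1 a2 a3 a4 a5 a6 M ->
  num_paths M =
    (\sum_(0 <= t < (min_entry M).+1)
       multinomial (line_sum M)
         [:: a1%:Z - t%:Z; a2%:Z - t%:Z; a3%:Z - t%:Z;
             a4%:Z + t%:Z; a5%:Z + t%:Z; a6%:Z + t%:Z]%R)%N.
Proof.
move=> up; pose c t := [:: a1 - t; a2 - t; a3 - t; a4 + t; a5 + t; a6 + t]%N.
pose word t := multiset_word steps (c t).
have cntE t : [seq count_mem P (word t) | P <- steps] = c t.
  exact: (count_multiset_word uniq_steps).
rewrite (@num_pathsE M
  [seq w | t <- iota 0 (min_entry M).+1, w <- permutations (word t)]).
- rewrite size_allpairs_dep sumnE big_map /index_iota subn0.
  apply: eq_big_seq => t; rewrite mem_iota /= add0n ltnS => le_t.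
  rewrite (size_permutations_multinomial uniq_steps) // (line_sum_represents up.1).
  (* In this range the truncated differences equal the integer ones, and the shifts cancel in the
     total. *)
  move: le_t; rewrite (leq_min_entry _ up) => /and3P[le1 le2 le3].
  by congr multinomial; [|congr [:: _; _; _; _; _; _]]; rewrite /=; lia.
- apply: allpairs_uniq_dep; first exact: iota_uniq.
    by move=> t _; apply: permutations_uniq.
  move=> _ _ /allpairsPdep[t1 [w1 [_ + ->]]] /allpairsPdep[t2 [w2 [_ + ->]]] /=.
  rewrite !mem_permutations => perm1 perm2 eq_w; rewrite -eq_w in perm2 *.
  (* Classes are disjoint: the multiplicity [a4 + t] of [P4] in the word determines [t]. *)
  have := cntE t1; rewrite -(eq_map (fun P => seq.permP perm1 (pred1 P))).
  rewrite (eq_map (fun P => seq.permP perm2 (pred1 P))) cntE => -[_ _ _ /addnI eq_t _ _].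
  by rewrite eq_t.
move=> w; split=> [/allpairsPdep[t [w' [+ + eq_w]]]|].
  rewrite mem_iota mem_permutations ltnS -{w'}eq_w => /= le_t perm_w.
  have sub_w : {subset w <= steps}.
    by move=> P; rewrite (perm_mem perm_w); apply: multiset_word_sub.
  split=> //; apply/(sum_stepsE _ sub_w)/(represents_shift _ _ _ _ _ _ up).
  exists t => //.
  by rewrite -[RHS](cntE t) -(eq_map (fun P => seq.permP perm_w (pred1 P))).
case=> sub_w /(sum_stepsE _ sub_w) /(represents_shift _ _ _ _ _ _ up)[t le_t cnt_w].
apply/allpairsPdep; exists t, w; split; rewrite ?mem_iota ?ltnS //.
rewrite mem_permutations (perm_eq_count sub_w (@multiset_word_sub _ steps (c t))) //.
by rewrite cntE.
Qed.

(** * Invariance under the group *)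

Lemma row_permD_perm (s t : 'S_3) (A : 'M[nat]_3) :
  row_perm s (A + perm_mx t) = row_perm s A + perm_mx (s * t).
Proof. by apply/matrixP => i j; rewrite !mxE permM. Qed.

Lemma col_permD_perm (s t : 'S_3) (A : 'M[nat]_3) :
  col_perm s (A + perm_mx t) = col_perm s A + perm_mx (t * s^-1).
Proof.
apply/matrixP => i j.
by rewrite !mxE permM eq_sym (canF_eq (permK s)) [in RHS]eq_sym.
Qed.

(** Step preservation by the inverse is carried along so that the induction passes through
    [in_G_inv] and paths can be pulled back. *)
Lemma in_G_automorphism (g : 'M[nat]_3 -> 'M[nat]_3) :
  in_G g -> exists h,
    [/\ cancel g h, cancel h g, g 0 = 0,
        {homo g : A B / perm_step A B} & {homo h : A B / perm_step A B}].
Proof.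
elim=> {g} [s|s|||g1 g2 _ [h1 [K1 V1 z1 g1P h1P]] _ [h2 [K2 V2 z2 g2P h2P]]
           |g h _ [h0 [K0 V0 z0 gP h0P]] gK hK].
- have rowP (t : 'S_3) : {homo row_perm t : A B / perm_step A B}.
    move=> A _ /existsP[r /eqP ->]; apply/existsP; exists (t * r)%g.
    by rewrite row_permD_perm.
  exists (row_perm s^-1); split; try exact: rowP.
  + by move=> A; apply/matrixP => i j; rewrite !mxE permKV.
  + by move=> A; apply/matrixP => i j; rewrite !mxE permK.
  + by apply/matrixP => i j; rewrite !mxE.
- have colP (t : 'S_3) : {homo col_perm t : A B / perm_step A B}.
    move=> A _ /existsP[r /eqP ->]; apply/existsP; exists (r * t^-1)%g.
    by rewrite col_permD_perm.
  exists (col_perm s^-1); split; try exact: colP.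
  + by move=> A; apply/matrixP => i j; rewrite !mxE permKV.
  + by move=> A; apply/matrixP => i j; rewrite !mxE permK.
  + by apply/matrixP => i j; rewrite !mxE.
- have trP : {homo trmx : A B / perm_step A B}.
    move=> A _ /existsP[r /eqP ->]; apply/existsP; exists r^-1%g.
    by rewrite -tr_perm_mx; apply/eqP/matrixP => i j; rewrite !mxE.
  by exists trmx; split=> //; [exact: trmxK | exact: trmxK | exact: trmx0].
- by exists id; split.
- exists (h2 \o h1); split.
  + exact: can_comp K1 K2.
  + exact: can_comp V2 V1.
  + by rewrite /= z2 z1.
  + by move=> A B /g2P /g1P.
  + by move=> A B /h1P /h2P.
(* Two-sided inverses are unique, so [g] and [h] just exchange roles. *)
- have eq_h A : h A = h0 A by rewrite -[in LHS](V0 A) gK.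
  exists g; split=> //; first by rewrite -z0 gK.
  by move=> A B /h0P; rewrite -!eq_h.
Qed.

Lemma num_paths_in_G (g : 'M[nat]_3 -> 'M[nat]_3) (M : 'M[nat]_3) :
  in_G g -> num_paths (g M) = num_paths M.
Proof.
case/in_G_automorphism => h [gK hK g0 gP hP].
have h0 : h 0 = 0 by rewrite -[in LHS]g0 gK.
have latticeP f N p : f 0 = 0 -> {homo f : A B / perm_step A B} ->
    lattice_path N p -> lattice_path (f N) (map f p).
  move=> f0 fP; rewrite !lattice_pathE -f0 last_map f0 => /andP[path_p /eqP ->].
  by rewrite eqxx andbT -f0 path_map; apply: sub_path path_p.
rewrite /num_paths.
have -> : lattice_paths (g M) = (map g @` lattice_paths M)%classic.
  apply/seteqP; split=> [p /= pP|_ /= [p pP <-]]; last exact: latticeP.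
  (* Surjectivity: a path to [g M] is pulled back termwise by [h]. *)
  exists (map h p); last by rewrite mapK.
  by rewrite /= -[M]gK; apply: latticeP.
rewrite fset_set_image; last exact: finite_lattice_paths.
by rewrite card_imfset //; apply: inj_map (can_inj gK).
Qed.

Theorem theorem5p1 (M : 'M[nat]_3) (hM : semimagic M) :
  (forall a1 a2 a3 a4 a5 a6 : nat,
     upshifted_representative a1 a2 a3 a4 a5 a6 M ->
     num_paths M =
       (\sum_(0 <= t < (min_entry M).+1)
          multinomial (line_sum M)
            [:: a1%:Z - t%:Z; a2%:Z - t%:Z; a3%:Z - t%:Z;
                a4%:Z + t%:Z; a5%:Z + t%:Z; a6%:Z + t%:Z]%R)%N)
  /\ (forall g : 'M[nat]_3 -> 'M[nat]_3, in_G g -> num_paths (g M) = num_paths M).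
Proof.
split=> [a1 a2 a3 a4 a5 a6|g]; first exact: num_paths_multinomial.
exact: num_paths_in_G.
Qed.
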